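(* Let $\overline{x}_1,\overline{x}_2,\overline{x}_3,\overline{x}_4\in\mathbb{R}^3$ and suppose that $\overline{x}_1$, $\overline{x}_2$ and $\overline{x}_3$ lie on a plane $P$. Then there exists a supporting plane for $\overline{x}_1,\dots,\overline{x}_4$ in $\mathbb{R}^3$ if and only if the set $\{\overline{x}_1,\dots,\overline{x}_4\}\cap P$ admits a supporting line in $P$.
   Context: All planes and lines are linear subspaces, i.e. they contain the origin; in particular $P$ is a 2-dimensional linear subspace of $\mathbb{R}^3$. A supporting plane for vectors in $\mathbb{R}^3$ is a 2-dimensional linear subspace such that all the vectors lie in the same open halfspace with respect to it; equivalently, there is a linear function $f:\mathbb{R}^3\to\mathbb{R}$ that is strictly positive on all of the vectors. Likewise, a supporting line in $P$ for a set of vectors of $P$ is a 1-dimensional linear subspace of $P$ such that all the vectors lie in the same open half-plane of $P$ with respect to it; equivalently, there is a linear function $g:P\to\mathbb{R}$ that is strictly positive on all of these vectors. *)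

(* Defs.v *)
From HB Require Import structures.
From mathcomp Require Import all_boot all_order all_algebra.
From mathcomp Require Import reals.

Set Implicit Arguments.
Unset Strict Implicit.
Unset Printing Implicit Defensive.

Import Order.TTheory GRing.Theory Num.Theory.

Local Open Scope ring_scope.

Definition open_halfspace (R : realType) (V : vectType R)
    (f : 'Hom(V, R^o)) : {pred V} :=
  [pred v | 0 < f v].

(* The two open half-spaces bounded by a hyperplane H are the positivity sets
   of f and of - f, for any linear form f with kernel H; quantifying over f
   therefore covers both sides of H. *)
Definition supporting_hyperplane (R : realType) (V : vectType R)
    (A : {pred V}) (H : {vspace V}) : Prop :=
  exists f : 'Hom(V, R^o), lker f = H /\ {subset A <= open_halfspace f}.

Definition supporting_plane (R : realType)
    (A : {pred 'rV[R]_3}) (H : {vspace 'rV[R]_3}) : Prop :=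
  \dim H = 2%N /\ supporting_hyperplane A H.

(* The set A :&: P, regarded as a set of vectors of the vector space P. *)
Definition trace_on (R : realType) (V : vectType R)
    (P : {vspace V}) (A : {pred V}) : {pred subvs_of P} :=
  [pred u : subvs_of P | vsval u \in A].
Arguments trace_on {R V} P A.

Definition supporting_line (R : realType) (V : vectType R) (P : {vspace V})
    (A : {pred subvs_of P}) (L : {vspace subvs_of P}) : Prop :=
  \dim L = 1%N /\ supporting_hyperplane A L.

(* Main.v *)
Require Import Defs.
From HB Require Import structures.
From mathcomp Require Import all_boot all_order all_algebra.
From mathcomp Require Import reals.

Set Implicit Arguments.
Unset Strict Implicit.
Unset Printing Implicit Defensive.

Import Order.TTheory GRing.Theory Num.Theory.

Local Open Scope ring_scope.

(** A linear form that is positive on some vector is nonzero, so its kernel is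
    automatically a hyperplane: a plane in R^3, a line in P.  The theorem is
    therefore about linear forms only ([supporting_hyperplane_existsE]): a form
    on R^3 positive on the four vectors against a form on P positive on those
    of them that lie in P.

    Restricting a form from R^3 to P gives one direction.  Conversely, a form
    on P extends to R^3, and x1, x2, x3 keep their values.  If x4 lies in P, so
    does x4.  If it does not, x4 is linearly independent of P, so the extension
    can be made to take the value 1 at x4 ([extend_form_with_value]). *)

(** The image of a nonzero linear form is the whole field, of dimension 1;
    rank-nullity gives the rest. *)
Lemma dim_lker_form (K : fieldType) (V : vectType K) (f : 'Hom(V, K^o))
    (v : V) :
  f v != 0 -> \dim (lker f) = (\dim {:V}).-1.
Proof.
move=> fv_neq0.
have dim_img : \dim (limg f) = 1%N.
  apply/eqP; rewrite eqn_leq; apply/andP; split.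
    by rewrite (leq_trans (dimvS (subvf _))) // dimvf.
  rewrite lt0n dimv_eq0; apply: contraNneq fv_neq0 => img0.
  by rewrite -memv0 -img0 memv_img ?memvf.
by rewrite -(limg_ker_dim f fullv) capfv dim_img addn1.
Qed.

(** Any projection onto P followed by g will do. *)
Lemma extend_form (K : fieldType) (V : vectType K) (P : {vspace V})
    (g : 'Hom(subvs_of P, K^o)) :
  exists f : 'Hom(V, K^o), forall u, f (vsval u) = g u.
Proof.
exists (g \o linfun (vsproj P))%VF => u.
by rewrite comp_lfunE lfunE /= vsvalK.
Qed.

(** With pi the projection onto P, some coordinate of v - pi v is nonzero at
    v = x, because x is outside P; as a function of v that coordinate is a
    linear form, and it vanishes on P. *)
Lemma form_separating (K : fieldType) (V : vectType K) (P : {vspace V})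
    (x : V) :
  x \notin P ->
  exists q : 'Hom(V, K^o), (forall v, v \in P -> q v = 0) /\ q x != 0.
Proof.
move=> xNP; pose r : 'End(V) := (\1 - projv P)%VF.
have rE v : r v = v - projv P v by rewrite add_lfunE opp_lfunE id_lfunE.
have rx_neq0 : r x != 0.
  by apply: contraNneq xNP; rewrite rE => /subr0_eq ->; apply: memv_proj.
have [i ri_neq0] : exists i, coord (vbasis {:V}) i (r x) != 0.
  apply/existsP; apply: contraNT rx_neq0; rewrite negb_exists => /forallP ri0.
  rewrite (coord_vbasis (memvf (r x))) big1 // => i _.
  by move: (ri0 i); rewrite negbK => /eqP->; rewrite scale0r.
exists (linfun (coord (vbasis {:V}) i : V -> K^o) \o r)%VF.
split=> [v vP|]; rewrite comp_lfunE; last by rewrite lfunE.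
by rewrite rE projv_id // subrr linear0.
Qed.

(** Adding to an extension of g a multiple of a form that vanishes on P but
    not at x adjusts the value at x freely. *)
Lemma extend_form_with_value (K : fieldType) (V : vectType K)
    (P : {vspace V}) (g : 'Hom(subvs_of P, K^o)) (x : V) (a : K) :
  x \notin P ->
  exists f : 'Hom(V, K^o), (forall u, f (vsval u) = g u) /\ f x = a.
Proof.
move=> /form_separating[q [q0 qx_neq0]]; have [h hE] := extend_form g.
exists (h + ((a - h x) / q x) *: q); split=> [u|].
  by rewrite add_lfunE scale_lfunE hE (q0 _ (subvsP u)) scaler0 addr0.
rewrite add_lfunE scale_lfunE -[_ *: _]/(_ * _).
by rewrite divfK // addrC subrK.
Qed.

Lemma supporting_hyperplane_existsE (R : realType) (V : vectType R)
    (A : {pred V}) (n : nat) (v : V) :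
  \dim {:V} = n.+1 -> v \in A ->
  (exists H, \dim H = n /\ supporting_hyperplane A H) <->
  (exists f : 'Hom(V, R^o), {subset A <= open_halfspace f}).
Proof.
move=> dimV vA; split=> [[H [_ [f [_ fA]]]] | [f fA]]; first by exists f.
exists (lker f); split; last by exists f.
have fv_gt0 : 0 < f v := fA v vA.
by rewrite (@dim_lker_form _ _ _ v) ?dimV // gt_eqF.
Qed.

Theorem theorem2 (R : realType) (x1 x2 x3 x4 : 'rV[R]_3)
    (P : {vspace 'rV[R]_3}) (dimP : \dim P = 2%N)
    (x1P : x1 \in P) (x2P : x2 \in P) (x3P : x3 \in P) :
  (exists H : {vspace 'rV[R]_3}, supporting_plane [in [:: x1; x2; x3; x4]] H) <->
  (exists L : {vspace subvs_of P},
     supporting_line (trace_on P [in [:: x1; x2; x3; x4]]) L).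
Proof.
set A : {pred 'rV[R]_3} := [in [:: x1; x2; x3; x4]].
have x1A : x1 \in A by rewrite !inE eqxx.
have x1T : vsproj P x1 \in trace_on P A by rewrite inE /= vsprojK.
have dimV : \dim {: 'rV[R]_3} = 3%N by rewrite dimvf.
have dimS : \dim {: subvs_of P} = 2%N by rewrite dimvf.
have planeE := supporting_hyperplane_existsE dimV x1A.
have lineE := supporting_hyperplane_existsE dimS x1T.
apply: (iff_trans planeE); apply: iff_sym; apply: (iff_trans lineE).
split=> [[g gA] | [f fA]]; last first.
  exists (f \o linfun vsval)%VF => u uA.
  by rewrite inE comp_lfunE lfunE; apply: fA.
have [f [fg fx4]] : exists f : 'Hom('rV[R]_3, R^o),
    (forall u, f (vsval u) = g u) /\ (x4 \notin P -> f x4 = 1).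
  have [x4P | x4NP] := boolP (x4 \in P).
    by have [f fg] := extend_form g; exists f.
  by have [f [fg fx4]] := extend_form_with_value g 1 x4NP; exists f.
exists f => x xA; rewrite inE.
have [xP | xNP] := boolP (x \in P).
  by rewrite -(vsprojK xP) fg; apply: gA; rewrite inE /= vsprojK.
suff eqx : x = x4 by rewrite eqx fx4 -?eqx // ltr01.
by move: xA xNP; rewrite !inE => /or4P[] /eqP-> //; rewrite ?x1P ?x2P ?x3P.
Qed.
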